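(* Let $G$ be a finite, undirected, simple graph with at least one vertex and with edge chromatic number $\chi'(G)$. Then, for every real $\lambda>0$, $$V_G(\lambda)\;\geq\;\frac{\lambda}{\bigl(1+(\chi'(G)+1)\lambda\bigr)^2},$$ with equality if and only if $G$ is a disjoint union of copies of $K_{\chi'(G)+1}$ and $\chi'(G)$ is either zero or odd.
   Context: All graphs are finite, undirected and simple, with at least one vertex. $K_m$ denotes the complete graph on $m$ vertices. The edge chromatic number $\chi'(G)$ is the minimum number of colors in a proper edge coloring of $G$ (an assignment of colors to edges such that any two edges sharing an endpoint receive distinct colors); by convention $\chi'(G)=0$ if $G$ has no edges. For a graph $G$ on $n$ vertices, $\mathcal{I}(G)$ is the set of all independent sets of $G$ (including the empty set), and the independence polynomial (partition function of the hard-core model) is $P_G(\lambda)=\sum_{I\in\mathcal{I}(G)}\lambda^{|I|}$ for $\lambda>0$. The hard-core model on $G$ at fugacity $\lambda$ is the probability measure on $\mathcal{I}(G)$ given by $\Pr[I]=\lambda^{|I|}/P_G(\lambda)$. The free energy density is $F_G(\lambda)=\frac1n\log P_G(\lambda)$, the occupancy fraction is $E_G(\lambda)=\lambda\frac{\partial}{\partial\lambda}F_G(\lambda)$, and the variance fraction is $V_G(\lambda)=\lambda\frac{\partial}{\partial\lambda}E_G(\lambda)$. Equivalently, $nE_G(\lambda)=\mathbb{E}(|I|)$ and $nV_G(\lambda)=\operatorname{Var}(|I|)$, where $I$ is drawn from the hard-core model on $G$ at fugacity $\lambda$. *)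

(* Defs.v *)
From mathcomp Require Import all_boot all_order all_algebra.
From mathcomp Require Import all_classical all_reals all_analysis.

Set Implicit Arguments.
Unset Strict Implicit.
Unset Printing Implicit Defensive.

Import Order.TTheory GRing.Theory Num.Theory.
Import numFieldNormedType.Exports.

Record sgraph := SGraph {
  vertex :> finType;
  adj : rel vertex;
  adj_sym : symmetric adj;
  adj_irrefl : irreflexive adj
}.

Definition isomorphic (G H : sgraph) : Prop :=
  exists f : G -> H, bijective f /\ forall x y, adj (f x) (f y) = adj x y.

Definition complete_adj (m : nat) : rel 'I_m := fun i j => i != j.

Lemma complete_adj_sym m : symmetric (@complete_adj m).
Proof. by move=> i j; rewrite /complete_adj eq_sym. Qed.

Lemma complete_adj_irrefl m : irreflexive (@complete_adj m).
Proof. by move=> i; rewrite /complete_adj eqxx. Qed.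

Definition complete (m : nat) : sgraph :=
  SGraph (@complete_adj_sym m) (@complete_adj_irrefl m).

(* The vertex (i, x) is the vertex x of the i-th copy of H. *)
Definition copies_adj (m : nat) (H : sgraph) : rel ('I_m * H) :=
  fun u v => (u.1 == v.1) && adj u.2 v.2.

Lemma copies_adj_sym m H : symmetric (@copies_adj m H).
Proof. by move=> u v; rewrite /copies_adj eq_sym adj_sym. Qed.

Lemma copies_adj_irrefl m H : irreflexive (@copies_adj m H).
Proof. by move=> u; rewrite /copies_adj adj_irrefl andbF. Qed.

Definition copies (m : nat) (H : sgraph) : sgraph :=
  SGraph (@copies_adj_sym m H) (@copies_adj_irrefl m H).

Definition disjoint_union_of_copies (G H : sgraph) : Prop :=
  exists m : nat, isomorphic G (copies m H).

Section EdgeColoring.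
Variable G : sgraph.

Definition edges : {set {set G}} :=
  [set A : {set G} | [exists x, exists y, adj x y && (A == [set x; y])]].

Definition edge : finType := {A : {set G} | A \in edges}.

Definition proper_edge_coloring k (c : {ffun edge -> 'I_k}) : bool :=
  [forall A : edge, forall B : edge,
    (A != B) && (~~ [disjoint val A & val B]) ==> (c A != c B)].

(* For k = 0 this says that G has no edges, {ffun edge -> 'I_0} being
   inhabited exactly when the type of edges is empty. *)
Definition edge_colorable k : bool :=
  [exists c : {ffun edge -> 'I_k}, proper_edge_coloring c].

Lemma ex_edge_colorable : exists k, edge_colorable k.
Proof.
exists #|edge|; apply/existsP; exists [ffun A => enum_rank A].
apply/forallP => A; apply/forallP => B; apply/implyP => /andP[neAB _].
by rewrite !ffunE (inj_eq enum_rank_inj).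
Qed.

Definition edge_chromatic_number : nat := ex_minn ex_edge_colorable.

End EdgeColoring.

Definition independent (G : sgraph) (I : {set G}) : bool :=
  [forall x in I, forall y in I, ~~ adj x y].

Local Open Scope ring_scope.

Section HardCore.
Variables (R : realType) (G : sgraph).

Definition indep_poly (l : R) : R :=
  \sum_(I : {set G} | independent I) l ^+ #|I|.

Definition free_energy (l : R) : R := #|G|%:R^-1 * ln (indep_poly l).

Definition occupancy_fraction (l : R) : R := l * free_energy^`()%classic l.

Definition variance_fraction (l : R) : R := l * occupancy_fraction^`()%classic l.

End HardCore.

(* Main.v *)
(* Let X = |I|, let U be the number of free vertices (those outside I with no
   neighbour in I), and put D = chi' + 1, which bounds the size of every closed
   neighbourhood. Adding a free vertex to I multiplies its weight by l, so
   E[sum over v in I of f(I)] = l E[sum over free v of f(I + v)]. With f = 1, X, U: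
     E X = l E U,   E X^2 = l E[U (X + 1)],   E[X U] = l E[U^2 - B],
   where B <= D U counts the ordered pairs of equal or adjacent free vertices.
   Eliminating E[X U] gives
     (1 + D l)^2 Var X = l E Y + l^2 (D E U - E B) + l^2 Var Y,   Y = D X + U,
   and Y >= n pointwise, since I and its neighbours number at most D X. This is
   the lower bound. Equality forces Y = n for every I: taking I of size 1 and 2
   shows that closed neighbourhoods have size D and partition the vertices.
   Conversely, if Y = n then E Y = n and Cov(X, U) = - D Var X, which determines
   Var X. Finally K_(chi' + 1) is chi'-edge-colourable with chi' > 0 only if it
   has a perfect matching, that is, if chi' is odd. *)
Require Import Defs.
From mathcomp Require Import all_boot all_order all_algebra.
From mathcomp Require Import all_classical all_reals all_analysis.
From mathcomp Require Import fintype finset zify ring lra.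

Set Implicit Arguments.
Unset Strict Implicit.
Unset Printing Implicit Defensive.

Import Order.TTheory GRing.Theory Num.Theory.

(** * Closed neighbourhoods, free vertices and partitions into cliques *)

Section ClosedNeighbourhoods.
Variable G : sgraph.
Implicit Types (u v w : G) (I J : {set G}).

Definition closed_nbhd v : {set G} := [set u | (u == v) || adj v u].

Definition free_vertices I : {set G} := ~: \bigcup_(v in I) closed_nbhd v.

Lemma closed_nbhd_sym u v : (u \in closed_nbhd v) = (v \in closed_nbhd u).
Proof. by rewrite !inE eq_sym adj_sym. Qed.

Lemma closed_nbhd_refl v : v \in closed_nbhd v.
Proof. by rewrite inE eqxx. Qed.

Lemma freeP u I :
  reflect {in I, forall v, u \notin closed_nbhd v} (u \in free_vertices I).
Proof.
rewrite inE; apply: (iffP idP) => [uI v vI | uI].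
  by apply: contra uI => uv; apply/bigcupP; exists v.
by apply/bigcupP => -[v vI]; apply/negP/uI.
Qed.

Lemma free0 : free_vertices set0 = setT.
Proof. by rewrite /free_vertices big_set0 setC0. Qed.

Lemma freeU1 v J : free_vertices (v |: J) = free_vertices J :\: closed_nbhd v.
Proof. by rewrite /free_vertices bigcup_setU big_set1 setCU setIC setDE. Qed.

Lemma free1 v : free_vertices [set v] = ~: closed_nbhd v.
Proof. by rewrite /free_vertices big_set1. Qed.

Lemma card_freeU1 v J :
  #|free_vertices J| = #|free_vertices (v |: J)| + #|free_vertices J :&: closed_nbhd v|.
Proof. by rewrite freeU1 addnC cardsID. Qed.

Lemma independentP I :
  reflect {in I &, forall x y, ~~ adj x y} (independent I).
Proof.
apply: (iffP 'forall_in_forall_inP) => iI x; first by move=> y xI; exact: iI.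
by move=> xI y yI; exact: iI.
Qed.

Lemma independent0 : independent (set0 : {set G}).
Proof. by apply/independentP => x y; rewrite inE. Qed.

Lemma independentU1 v J : v \notin J ->
  independent (v |: J) = independent J && (v \in free_vertices J).
Proof.
move=> vJ; apply/independentP/andP => [iJ | [/independentP iJ /freeP vfree] x y].
  split; first by apply/independentP => x y xJ yJ; apply: iJ; rewrite inE ?xJ ?yJ orbT.
  apply/freeP => u uJ; rewrite inE negb_or (contraNneq _ vJ) => [|->//].
  by apply: iJ; rewrite !inE ?eqxx ?uJ ?orbT.
rewrite !inE => /predU1P[->|xJ] /predU1P[->|yJ]; last exact: iJ.
- by rewrite adj_irrefl.
- by have := vfree y yJ; rewrite inE negb_or adj_sym => /andP[].
- by have := vfree x xJ; rewrite inE negb_or => /andP[].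
Qed.

Lemma independent1 v : independent [set v].
Proof. by apply/independentP => x y /set1P-> /set1P->; rewrite adj_irrefl. Qed.

(** Induction on [#|I|]: putting [v] back into [I] covers only free vertices of [closed_nbhd v], so
    at most [D] of them. *)
Lemma card_le_covered_free D I : (forall v, #|closed_nbhd v| <= D) ->
  #|G| <= D * #|I| + #|free_vertices I|.
Proof.
move=> leD; have [k] := ubnP #|I|; elim: k I => // k IHk I.
have [->|[v vI]] := set_0Vmem I; first by rewrite free0 cardsT leq_addl.
rewrite (cardsD1 v) vI add1n ltnS => /IHk; rewrite -{4}(setD1K vI).
have := card_freeU1 v (I :\ v).
by have := subset_leq_card (subsetIr (free_vertices (I :\ v)) (closed_nbhd v)); have := leD v; nia.
Qed.

(** Closed neighbourhoods meet only if they are equal, so they partition the vertices into cliques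
    of size [D]. *)
Definition clique_blocks D : Prop :=
  (forall v, #|closed_nbhd v| = D) /\
  (forall u v, u \in closed_nbhd v -> closed_nbhd u = closed_nbhd v).

(** The induction of [card_le_covered_free] loses nothing here: by independence no other vertex of
    [I] lies in the block of [v], so putting [v] back covers exactly [D] new vertices. *)
Lemma clique_blocks_card_free D I : clique_blocks D -> independent I ->
  D * #|I| + #|free_vertices I| = #|G|.
Proof.
move=> [cardD eq_cl]; have [k] := ubnP #|I|; elim: k I => // k IHk I.
have [->|[v vI]] := set_0Vmem I; first by rewrite free0 cards0 cardsT muln0.
rewrite (cardsD1 v) vI add1n ltnS => ltk; rewrite -{1 3}(setD1K vI).
rewrite independentU1 ?setD11 // => /andP[/(IHk _ ltk) <- vfree].
rewrite (card_freeU1 v (I :\ v)); suff -> : free_vertices (I :\ v) :&: closed_nbhd v = closed_nbhd v.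
  by rewrite cardD; lia.
apply/setIidPr/subsetP => u uv; apply/freeP => w wI; apply/negP => uw.
by have /negP[] := freeP _ _ vfree w wI; rewrite -(eq_cl u w uw) closed_nbhd_sym.
Qed.

(** Singletons give the sizes. If [u] is in [closed_nbhd v] and [w] in [closed_nbhd u] but not in
    [closed_nbhd v], then the independent set formed by [v] and [w] forces [closed_nbhd w] to avoid
    [closed_nbhd v], although [u] lies in both. *)
Lemma card_free_clique_blocks D :
  (forall I, independent I -> D * #|I| + #|free_vertices I| = #|G|) -> clique_blocks D.
Proof.
move=> eqD.
have cardD v : #|closed_nbhd v| = D.
  have := eqD _ (independent1 v); have := cardsC (closed_nbhd v).
  by rewrite cards1 free1; lia.
suff sub_cl u v : u \in closed_nbhd v -> closed_nbhd u \subset closed_nbhd v.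
  split=> // u v uv; apply/eqP; rewrite eqEsubset !sub_cl //.
  by rewrite closed_nbhd_sym.
move=> uv; apply/subsetP => w wu; apply/negPn/negP => wv.
have wNv : w \notin [set v] by apply: contra wv => /set1P->; exact: closed_nbhd_refl.
have iwv : independent (w |: [set v]).
  by rewrite independentU1 // independent1 free1 inE.
have /setIidPr/fintype.subsetP/(_ u) : free_vertices [set v] :&: closed_nbhd w = closed_nbhd w.
  apply/eqP; rewrite eqEcard subsetIr /=.
  have := eqD _ iwv; have := eqD _ (independent1 v); have := card_freeU1 w [set v].
  by rewrite cardsU1 wNv cards1 cardD; lia.
by rewrite closed_nbhd_sym wu free1 inE uv => /(_ isT).
Qed.
End ClosedNeighbourhoods.

(** * Edge colourings, degrees and parity *)

Section EdgeColourings.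
Variable G : sgraph.

Lemma edge_colorable_fun k : edge_colorable G k ->
  exists col : G -> G -> nat,
    [/\ forall x y, col x y = col y x,
        forall x y, adj x y -> col x y < k &
        forall x y z, adj x y -> adj x z -> col x y = col x z -> y = z].
Proof.
move=> /existsP[c /forallP proper_c].
(* Non-adjacent pairs get the value [k], which is not a colour. *)
pose col x y := oapp (fun e : edge G => val (c e)) k (insub [set x; y]).
have colE x y : adj x y ->
    exists2 e : edge G, val e = [set x; y] & col x y = c e.
  move=> xy; have xyE : [set x; y] \in edges G.
    by rewrite inE; apply/existsP; exists x; apply/existsP; exists y; rewrite xy eqxx.
  by exists (Sub [set x; y] xyE); rewrite // /col insubT.
exists col; split=> [x y|x y xy|x y z xy xz].
- by rewrite /col finset.setUC.
- by have [e _ ->] := colE x y xy.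
have [e eE ->] := colE x y xy; have [e' e'E ->] := colE x z xz => /val_inj cee'.
have /implyP := forallP (proper_c e) e'; rewrite cee' eqxx eE e'E.
have [ee' _|_] /= := eqVneq e e'; last first.
  have /[swap]/[apply]// : ~~ [disjoint [set x; y] & [set x; z]].
  by apply/pred0Pn; exists x; rewrite /= !inE eqxx.
have : y \in [set x; z] by rewrite -e'E -ee' eE !inE eqxx orbT.
by rewrite !inE => /predU1P[yx|/eqP//]; move: xy; rewrite yx adj_irrefl.
Qed.

Lemma edge_chromatic_number_colorable : edge_colorable G (edge_chromatic_number G).
Proof. by rewrite /edge_chromatic_number; case: ex_minnP. Qed.

Lemma closed_nbhdE (v : G) : closed_nbhd v = v |: [set u | adj v u].
Proof. by apply/setP => u; rewrite !inE. Qed.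

Lemma card_closed_nbhd (v : G) : #|closed_nbhd v| = #|[set u | adj v u]|.+1.
Proof. by rewrite closed_nbhdE cardsU1 inE adj_irrefl. Qed.

(** The edges at [v] have distinct colours, so the degree is at most the number of colours. *)
Lemma card_closed_nbhd_le (v : G) :
  #|closed_nbhd v| <= (edge_chromatic_number G).+1.
Proof.
have [col [_ ltcol injcol]] := edge_colorable_fun edge_chromatic_number_colorable.
rewrite card_closed_nbhd ltnS cardE -(size_map (col v)) -(size_iota 0 (edge_chromatic_number G)).
apply: uniq_leq_size => [|_ /mapP[u uN ->]].
  rewrite map_inj_in_uniq ?enum_uniq // => x y; rewrite !mem_enum !inE.
  exact: injcol.
by rewrite mem_iota ltcol //; move: uN; rewrite mem_enum inE.
Qed.

(* A colour class is a perfect matching of each block, since every vertex meets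
   all the colours. *)
Lemma clique_blocks_odd (v : G) :
  clique_blocks G (edge_chromatic_number G).+1 ->
  edge_chromatic_number G = 0 \/ odd (edge_chromatic_number G).
Proof.
move=> [cardD eq_cl].
have [col [colC ltcol injcol]] := edge_colorable_fun edge_chromatic_number_colorable.
case: (posnP (edge_chromatic_number G)) => [|chi_gt0]; [by left | right].
(* The edges at [x] are as many as the colours, so every colour occurs at [x], in particular colour
   0. *)
have full x : exists2 y, adj x y & col x y = 0.
  pose s := [seq col x y | y <- enum [set y | adj x y]].
  have [|||_ sE] := @uniq_min_size _ s (iota 0 (edge_chromatic_number G)).
  - rewrite map_inj_in_uniq ?enum_uniq // => y z; rewrite !mem_enum !inE.
    exact: injcol.
  - by move=> _ /mapP[u uN ->]; rewrite mem_iota ltcol //; move: uN; rewrite mem_enum inE.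
  - by rewrite size_iota size_map -cardE -ltnS -card_closed_nbhd cardD.
  have := sE 0; rewrite mem_iota chi_gt0 => /mapP[y].
  by rewrite mem_enum inE => xy y0; exists y.
(* The classes of [r] inside the block of [v] are the edges of colour 0. *)
pose r x y := (x == y) || (adj x y && (col x y == 0)).
have req : {in closed_nbhd v & &, equivalence_rel r}.
  move=> x y z _ _ _; split; first by rewrite /r eqxx.
  rewrite /r => /predU1P[->//|/andP[xy /eqP xy0]].
  have yx : adj y x by rewrite adj_sym.
  have yx0 : col y x = 0 by rewrite colC.
  apply/idP/idP.
    move=> /predU1P[<-|/andP[xz /eqP xz0]]; first by rewrite yx yx0 orbT.
    by rewrite (injcol x y z) ?eqxx // xz0.
  move=> /predU1P[<-|/andP[yz /eqP yz0]]; first by rewrite xy xy0 orbT.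
  by rewrite (injcol y x z) ?eqxx // yz0.
have card2 : {in equivalence_partition r (closed_nbhd v), forall A : {set G}, #|A| = 2}.
  move=> _ /imsetP[x xv ->]; have [y xy xy0] := full x.
  suff -> : [set z in closed_nbhd v | r x z] = [set x; y].
    by rewrite cards2; case: eqVneq xy => // ->; rewrite adj_irrefl.
  apply/setP => z; rewrite in_set in_set2 /r [x == z]eq_sym.
  apply/andP/orP => [[_ /predU1P[->|/andP[xz /eqP xz0]]]|[/eqP->|/eqP->]].
  - by left.
  - by right; rewrite (injcol x y z) // ?xy0.
  - by rewrite xv eqxx.
  - by rewrite -(eq_cl x v xv) inE xy xy0 eqxx !orbT.
have := card_uniform_partition card2 (equivalence_partitionP req).
by rewrite cardD => /(congr1 odd); rewrite muln2 odd_double /= => /negPn.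
Qed.

End EdgeColourings.

(** * Clique blocks as copies of a complete graph *)

Section CopiesOfComplete.
Variable G : sgraph.

Lemma clique_blocks_copies d : 0 < #|G| -> clique_blocks G d.+1 ->
  disjoint_union_of_copies G (complete d.+1).
Proof.
move=> /card_gt0P[v0 _] [cardD eq_cl].
pose P := [set closed_nbhd v | v : G].
have P0 : closed_nbhd v0 \in P by exact: imset_f.
have adjE (x y : G) : adj x y = (closed_nbhd x == closed_nbhd y) && (x != y).
  apply/idP/andP => [xy|[/eqP xy neq_xy]].
    split; first by apply/eqP; apply: eq_cl; rewrite inE adj_sym xy orbT.
    by apply: contraTneq xy => ->; rewrite adj_irrefl.
  have := closed_nbhd_refl y; rewrite -xy inE eq_sym.
  by rewrite (negPf neq_xy).
(* The isomorphism sends [v] to the number of its block and its position within that block; it is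
   injective, and counting the blocks makes it bijective. *)
pose h (v : G) : 'I_#|P| := enum_rank_in P0 (closed_nbhd v).
pose k (v : G) : 'I_d.+1 := inord (index v (enum (closed_nbhd v))).
have hE x y : (h x == h y) = (closed_nbhd x == closed_nbhd y).
  apply/eqP/eqP => [/enum_rank_in_inj|]; first by apply; exact: imset_f.
  by rewrite /h => ->.
have hk_inj x y : h x = h y -> k x = k y -> x = y.
  move=> /eqP; rewrite hE => /eqP xy /(congr1 val).
  have idx (z : G) : index z (enum (closed_nbhd z)) < d.+1.
    by rewrite -(cardD z) cardE index_mem mem_enum closed_nbhd_refl.
  rewrite /= !inordK // -xy => /(index_inj x); apply; rewrite mem_enum.
    exact: closed_nbhd_refl.
  by rewrite xy closed_nbhd_refl.
exists #|P|; exists (fun v => (h v, k v)); split.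
  apply: inj_card_bij => [x y [/hk_inj xy /xy //]|].
  rewrite card_prod !card_ord -cardsT.
  rewrite -(@card_uniform_partition _ d.+1 P setT) //.
    by move=> _ /imsetP[v _ ->].
  apply/and3P; split.
  - apply/eqP/setP => v; rewrite inE; apply/bigcupP.
    by exists (closed_nbhd v); [exact: imset_f | exact: closed_nbhd_refl].
  - apply/trivIsetP => _ _ /imsetP[x _ ->] /imsetP[y _ ->]; apply: contraNT.
    by move=> /pred0Pn[z /andP[/= zx zy]]; rewrite -(eq_cl z x zx) (eq_cl z y zy).
  - by apply/negP => /imsetP[x _ /setP/(_ x)]; rewrite closed_nbhd_refl inE.
move=> x y; rewrite adjE /adj /= /copies_adj /= /complete_adj hE.
case: eqVneq => //= xy; congr (~~ _); apply/eqP/eqP => [|->//].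
by apply: hk_inj; apply/eqP; rewrite hE xy.
Qed.

(** A closed neighbourhood is the preimage of one whole copy. *)
Lemma copies_clique_blocks d :
  disjoint_union_of_copies G (complete d.+1) -> clique_blocks G d.+1.
Proof.
move=> [m [f [f_bij fadj]]].
have clE v : closed_nbhd v = f @^-1: [set p | p.1 == (f v).1].
  apply/setP => u; rewrite !inE -fadj -(inj_eq (bij_inj f_bij)).
  case: (f u) (f v) => [i a] [j b]; rewrite /adj /= /copies_adj /= /complete_adj.
  by rewrite xpair_eqE [j == i]eq_sym [b == a]eq_sym -andb_orr orbN andbT.
split=> [v|u v]; last by rewrite !clE !inE => /eqP->.
rewrite clE on_card_preimset; last exact: onW_bij.
have -> : [set p : copies m (complete d.+1) | p.1 == (f v).1] = setX [set (f v).1] setT.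
  by apply/setP => p; rewrite !inE andbT.
by rewrite cardsX cards1 cardsT card_ord mul1n.
Qed.

End CopiesOfComplete.

Local Open Scope ring_scope.

(** * Moment identities for the hard-core weights *)

Section WeightedSums.
Variables (R : realType) (G : sgraph) (l : R).
Hypothesis l_gt0 : 0 < l.
Implicit Types (f g : {set G} -> R) (I J : {set G}).

(** The expectation of [f] times the partition function; leaving it unnormalised avoids division. *)
Definition wsum f : R := \sum_(I : {set G} | independent I) l ^+ #|I| * f I.

Lemma eq_wsum f g : (forall I, independent I -> f I = g I) -> wsum f = wsum g.
Proof. by move=> fg; apply: eq_bigr => I /fg->. Qed.

Lemma wsumD f g : wsum (fun I => f I + g I) = wsum f + wsum g.
Proof. by rewrite -big_split; apply: eq_bigr => I _; rewrite mulrDr. Qed.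

Lemma wsumZ (a : R) f : wsum (fun I => a * f I) = a * wsum f.
Proof. by rewrite mulr_sumr; apply: eq_bigr => I _; rewrite mulrCA. Qed.

Lemma wsum_ge0 f : (forall I, independent I -> 0 <= f I) -> 0 <= wsum f.
Proof.
by move=> f0; apply: sumr_ge0 => I /f0; apply: mulr_ge0; rewrite exprn_ge0 ?ltW.
Qed.

Lemma wsum_eq0 f : (forall I, independent I -> 0 <= f I) -> wsum f = 0 ->
  forall I, independent I -> f I = 0.
Proof.
move=> f0 /psumr_eq0P sum0 I iI.
have /eqP := sum0 (fun J iJ => mulr_ge0 (exprn_ge0 _ (ltW l_gt0)) (f0 J iJ)) I iI.
by rewrite mulf_eq0 expf_eq0 gt_eqF // andbF => /eqP.
Qed.

Lemma wsum1_gt0 : 0 < wsum (fun=> 1).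
Proof.
rewrite /wsum (bigD1 set0) ?independent0 //= cards0 expr0 mulr1 ltr_wpDr //.
by apply: sumr_ge0 => I _; rewrite mulr1 exprn_ge0 ?ltW.
Qed.

Definition occupied I : R := #|I|%:R.
Definition uncovered I : R := #|free_vertices I|%:R.

(** Double counting: removing [v] matches the pairs of an independent [I] and [v] in [I] with the
    pairs of an independent [J] and a free vertex [v] of [J], at the cost of one factor [l]. *)
Lemma wsum_card f :
  wsum (fun I => occupied I * f I) =
  l * wsum (fun J => \sum_(v in free_vertices J) f (v |: J)).
Proof.
transitivity (\sum_(v : G) \sum_(I : {set G} | independent I && (v \in I)) l ^+ #|I| * f I).
  rewrite (exchange_big_dep (fun I => independent I)) /=; last by move=> v I _ /andP[].
  apply: eq_bigr => I iI; rewrite (eq_bigl (mem I)); last by move=> v; rewrite iI.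
  by rewrite sumr_const mulrCA mulr_natl.
transitivity (\sum_(v : G) \sum_(J : {set G} | independent J && (v \in free_vertices J))
    l * (l ^+ #|J| * f (v |: J))).
  apply: eq_bigr => v _.
  rewrite (reindex_onto (fun J => v |: J) (fun I => I :\ v)) /=; last first.
    by move=> I /andP[_ vI]; rewrite setD1K.
  apply: congr_big => // J.
    (* If [v] is in [J], both conditions fail: [(v |: J) :\ v] differs from [J], and [v] is not
       free. *)
    have [vJ|vJ] := boolP (v \in J).
      rewrite [_ == J]eqEsubset [J \subset _]subsetD1 vJ !andbF; apply/esym/negbTE.
      rewrite negb_and; apply/orP; right; apply/negP => /freeP/(_ v vJ).
      by rewrite closed_nbhd_refl.
    by rewrite independentU1 // setU11 setU1K // eqxx !andbT.
  by case/andP=> _ /eqP eJ; rewrite cardsU1 -{1}eJ setD11 add1n exprS -mulrA.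
rewrite (exchange_big_dep (fun I => independent I)) /=; last by move=> v I _ /andP[].
rewrite mulr_sumr; apply: eq_bigr => J iJ.
rewrite (eq_bigl (mem (free_vertices J))); last by move=> v; rewrite iJ.
by rewrite !mulr_sumr.
Qed.

Definition uncovered_pairs I : R :=
  \sum_(v in free_vertices I) #|free_vertices I :&: closed_nbhd v|%:R.

Lemma wsum_occupied : wsum occupied = l * wsum uncovered.
Proof.
rewrite -(eq_wsum (fun I _ => mulr1 (occupied I))) wsum_card; congr (_ * _).
by apply: eq_wsum => J _; rewrite sumr_const.
Qed.

Lemma wsum_occupied2 :
  wsum (fun I => occupied I * occupied I) =
  l * (wsum (fun I => occupied I * uncovered I) + wsum uncovered).
Proof.
rewrite (wsum_card occupied) -wsumD; congr (_ * _); apply: eq_wsum => J _.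
rewrite (eq_bigr (fun=> occupied J + 1)) => [|v /freeP vJ]; last first.
  have vNJ : v \notin J.
    by apply/negP => /vJ; rewrite closed_nbhd_refl.
  by rewrite /occupied cardsU1 vNJ addnC natrD.
by rewrite sumr_const -mulr_natl mulrDr mulr1 mulrC.
Qed.

(** Adding a free [v] removes the free vertices of [closed_nbhd v]; summed over [v], this loss is
    [uncovered_pairs]. *)
Lemma wsum_occupied_uncovered :
  wsum (fun I => occupied I * uncovered I) =
  l * (wsum (fun I => uncovered I * uncovered I) - wsum uncovered_pairs).
Proof.
rewrite (wsum_card uncovered) -[- wsum _]mulN1r -(wsumZ (-1)) -wsumD; congr (_ * _).
apply: eq_wsum => J _; rewrite mulN1r {2}/uncovered mulr_natl -sumr_const -sumrB.
by apply: eq_bigr => v _; rewrite {2}/uncovered (card_freeU1 v) natrD addrK.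
Qed.

Lemma wsum_uncovered_pairs_le D : (forall v : G, #|closed_nbhd v| <= D)%N ->
  wsum uncovered_pairs <= D%:R * wsum uncovered.
Proof.
move=> leD; rewrite -wsumZ -subr_ge0 -[- wsum _]mulN1r -(wsumZ (-1)) -wsumD.
apply: wsum_ge0 => J _; rewrite mulN1r subr_ge0 mulr_natr -sumr_const.
apply: ler_sum => v _; rewrite ler_nat (leq_trans _ (leD v)) //.
by rewrite subset_leq_card ?subsetIr.
Qed.

(** Expand the nonnegative sum of [(Z * f I - y) ^+ 2] and cancel one factor [Z]. *)
Lemma wsum_cauchy_schwarz f :
  wsum f ^+ 2 <= wsum (fun=> 1) * wsum (fun I => f I * f I).
Proof.
set Z := wsum (fun=> 1); set y := wsum f.
have : 0 <= wsum (fun I => (Z * f I - y) ^+ 2).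
  by apply: wsum_ge0 => I _; exact: sqr_ge0.
have -> : wsum (fun I => (Z * f I - y) ^+ 2) =
    Z * (Z * wsum (fun I => f I * f I) - y ^+ 2).
  transitivity (wsum (fun I => Z ^+ 2 * (f I * f I) + (- (2 * Z * y) * f I + y ^+ 2 * 1))).
    by apply: eq_wsum => I _; ring.
  by rewrite !wsumD !wsumZ -/Z -/y; ring.
by rewrite pmulr_rge0 ?subr_ge0 // wsum1_gt0.
Qed.

(* [V] is [Z ^+ 2 * Var |I|]; the excess over the lower bound splits
   into the slack of the pointwise bound [#|G| <= D * #|I| + #|free_vertices I|],
   the slack in the degrees, and the variance of [D * #|I| + #|free_vertices I|]. *)
Lemma wsum_variance D : (forall v : G, #|closed_nbhd v| <= D)%N ->
  let Z := wsum (fun=> 1) in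
  let V := Z * wsum (fun I => occupied I * occupied I) - wsum occupied ^+ 2 in
  l * #|G|%:R * Z ^+ 2 <= V * (1 + D%:R * l) ^+ 2 /\
  (V * (1 + D%:R * l) ^+ 2 = l * #|G|%:R * Z ^+ 2 <->
   forall I, independent I -> (D * #|I| + #|free_vertices I|)%N = #|G|).
Proof.
move=> leD Z V; pose Y I := D%:R * occupied I + uncovered I.
have Z_gt0 : 0 < Z := wsum1_gt0.
pose n : R := #|G|%:R.
have YE I : Y I = (D * #|I| + #|free_vertices I|)%N%:R by rewrite natrD natrM.
have nY I : 0 <= Y I + - n.
  by rewrite subr_ge0 YE ler_nat card_le_covered_free.
have YnE : wsum (fun I => Y I + - n) = wsum Y - n * Z.
  by rewrite wsumD -mulNr -wsumZ; congr (_ + _); apply: eq_wsum => I _; rewrite mulr1.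
have nY_sum : 0 <= wsum Y - n * Z by rewrite -YnE; exact: wsum_ge0.
have WY : wsum Y = D%:R * wsum occupied + wsum uncovered by rewrite wsumD wsumZ.
have WYY : wsum (fun I => Y I * Y I) =
    D%:R ^+ 2 * wsum (fun I => occupied I * occupied I) +
    (2 * D%:R * wsum (fun I => occupied I * uncovered I) +
     wsum (fun I => uncovered I * uncovered I)).
  rewrite -!wsumZ -!wsumD; apply: eq_wsum => I _; rewrite /Y; ring.
have VY := wsum_cauchy_schwarz Y; rewrite -/Z -subr_ge0 in VY.
have Bu := wsum_uncovered_pairs_le leD; rewrite -subr_ge0 in Bu.
have excess : V * (1 + D%:R * l) ^+ 2 - l * n * Z ^+ 2 =
    l * Z * (wsum Y - n * Z) +
    l ^+ 2 * Z * (D%:R * wsum uncovered - wsum uncovered_pairs) +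
    l ^+ 2 * (Z * wsum (fun I => Y I * Y I) - wsum Y ^+ 2).
  by rewrite WYY WY /V wsum_occupied2 wsum_occupied_uncovered wsum_occupied; ring.
have lZ_ge0 : 0 <= l * Z by rewrite mulr_ge0 // ltW.
have e1 : 0 <= l * Z * (wsum Y - n * Z) by exact: mulr_ge0.
have e2 : 0 <= l ^+ 2 * Z * (D%:R * wsum uncovered - wsum uncovered_pairs).
  by rewrite mulr_ge0 // expr2 -mulrA mulr_ge0 // ltW.
have e3 : 0 <= l ^+ 2 * (Z * wsum (fun I => Y I * Y I) - wsum Y ^+ 2).
  by rewrite mulr_ge0 ?sqr_ge0.
split; first by rewrite -subr_ge0 excess; lra.
split=> [eqV I iI|eqn].
  (* The three nonnegative terms of [excess] sum to zero; the first one already forces [Y I = n] for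
     every independent [I]. *)
  have /eqP : l * Z * (wsum Y - n * Z) = 0 by move: excess; rewrite eqV -/n; lra.
  rewrite !mulf_eq0 (gt_eqF l_gt0) (gt_eqF Z_gt0) /= => /eqP; rewrite -YnE.
  move=> /(wsum_eq0 (fun J _ => nY J)) /(_ I iI) /eqP.
  by rewrite subr_eq0 YE eqr_nat => /eqP.
have YnI I : independent I -> Y I = n by move=> /eqn; rewrite YE => ->.
have yn : wsum Y = n * Z.
  by rewrite -wsumZ; apply: eq_wsum => I /YnI ->; rewrite mulr1.
(* [Y = n] multiplied by [occupied] and summed; with [yn] and [wsum_occupied2] it determines [u] and
   [x2] up to the factor [1 + D%:R * l]. *)
have xn : D%:R * wsum (fun I => occupied I * occupied I) +
    wsum (fun I => occupied I * uncovered I) = n * wsum occupied.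
  by rewrite -!wsumZ -wsumD; apply: eq_wsum => I /YnI <-; rewrite /Y; ring.
move: yn xn; rewrite WY -/n /V wsum_occupied.
have := wsum_occupied2.
set x2 := wsum (fun I => _ I * _ I); set u := wsum uncovered => x2E yn xn.
have uE : u * (1 + D%:R * l) = n * Z by rewrite -yn; ring.
have x2D : x2 * (1 + D%:R * l) = l * (n * (l * u) + u).
  by rewrite -xn mulrDr mulr1 {1}x2E; ring.
have -> : (Z * x2 - (l * u) ^+ 2) * (1 + D%:R * l) ^+ 2 =
    (Z * (x2 * (1 + D%:R * l)) - l ^+ 2 * u * (u * (1 + D%:R * l))) * (1 + D%:R * l).
  by ring.
have -> : Z * (x2 * (1 + D%:R * l)) - l ^+ 2 * u * (u * (1 + D%:R * l)) = l * Z * u.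
  by rewrite x2D uE; ring.
by rewrite -mulrA uE; ring.
Qed.
End WeightedSums.

(** * The variance fraction in terms of weighted sums *)

Section VarianceFraction.
Variables (R : realType) (G : sgraph).
Implicit Type x : R.

(** A formal polynomial, so that its derivatives are computed algebraically. *)
Definition ipoly : {poly R} := \sum_(I : {set G} | independent I) 'X^#|I|.

Lemma horner_ipoly x : ipoly.[x] = wsum x (fun _ : {set G} => 1).
Proof.
by rewrite horner_sum; apply: eq_bigr => I _; rewrite hornerXn mulr1.
Qed.

Lemma indep_polyE x : indep_poly G x = ipoly.[x].
Proof. by rewrite horner_sum; apply: eq_bigr => I _; rewrite hornerXn. Qed.

Lemma Xderiv_sum (p : {poly R}) (f : {set G} -> R) :
  p = \sum_(I : {set G} | independent I) (f I)%:P * 'X^#|I| ->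
  'X * p^`() = \sum_(I : {set G} | independent I) (f I * #|I|%:R)%:P * 'X^#|I|.
Proof.
move=> ->; rewrite [_^`()]raddf_sum mulr_sumr /=; apply: eq_bigr => I _.
rewrite /= derivM derivC mul0r add0r derivXn polyCM polyC_natr.
case: #|I| => [|k]; first by rewrite !mulr0n !mulr0 mul0r.
by rewrite /= exprS -[_ *+ _]mulr_natl; ring.
Qed.

Lemma horner_wsum (f : {set G} -> R) x :
  (\sum_(I : {set G} | independent I) (f I)%:P * 'X^#|I|).[x] = wsum x f.
Proof.
by rewrite horner_sum; apply: eq_bigr => I _; rewrite hornerCM hornerXn mulrC.
Qed.

Lemma occupancy_fractionE x : 0 < x ->
  occupancy_fraction G x = #|G|%:R^-1 * (('X * ipoly^`()).[x] / ipoly.[x]).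
Proof.
move=> x_gt0; rewrite /occupancy_fraction.
have p_gt0 : 0 < ipoly.[x] by rewrite horner_ipoly wsum1_gt0.
have -> : free_energy (R:=R) G = #|G|%:R^-1 *: (@ln R \o horner ipoly).
  by apply/funext => y; rewrite /free_energy indep_polyE.
have d1 := is_derive1_ln p_gt0.
rewrite derive1E.
have dln : is_derive x (1 : R) (@ln R \o horner ipoly) (ipoly.[x]^-1 * ipoly^`().[x]).
  exact: is_derive1_comp.
rewrite derive_val /= hornerM hornerX /GRing.scale /=; ring.
Qed.

Lemma variance_fractionE x : 0 < x ->
  variance_fraction G x = #|G|%:R^-1 *
    ((ipoly.[x] * ('X * ('X * ipoly^`())^`()).[x] - ('X * ipoly^`()).[x] ^+ 2) /
     ipoly.[x] ^+ 2).
Proof.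
move=> x_gt0; rewrite /variance_fraction derive1E.
have p_gt0 : 0 < ipoly.[x] by rewrite horner_ipoly wsum1_gt0.
set p := ipoly; set q := 'X * p^`().
have dp : is_derive x (1 : R) (fun y => (p.[y])^-1) (- p.[x] ^- 2 *: p^`().[x]).
  by apply: is_deriveV; rewrite gt_eqF.
have dq := is_deriveZ #|G|%:R^-1 (is_deriveM (is_derive_poly q x) dp).
have -> : 'D_1 (occupancy_fraction (R:=R) G) x =
    'D_1 (#|G|%:R^-1 *: (horner q * (fun y => (p.[y])^-1))) x.
  (* [occupancy_fractionE] needs a positive argument, so the two functions are compared only near
     [x]. *)
  apply: near_eq_derive; near=> y.
  by rewrite occupancy_fractionE //; near: y; exact: lt_nbhsr.
rewrite derive_val /= /GRing.scale /=.
rewrite !hornerM !hornerX; move: (#|G|%:R^-1) {dq} => k; field.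
exact: lt0r_neq0.
Unshelve. all: by end_near.
Qed.

Lemma variance_fraction_wsum x : 0 < x ->
  let Z := wsum x (fun _ : {set G} => 1) in
  variance_fraction G x = #|G|%:R^-1 *
    ((Z * wsum x (fun I : {set G} => occupied R I * occupied R I) -
      wsum x (@occupied R G) ^+ 2) / Z ^+ 2).
Proof.
move=> x_gt0 Z; rewrite variance_fractionE // horner_ipoly.
have p1 : ipoly = \sum_(I : {set G} | independent I) 1%:P * 'X^#|I|.
  by apply: eq_bigr => I _; rewrite mul1r.
have q1 := Xderiv_sum p1; have r1 := Xderiv_sum q1.
rewrite r1 q1 !horner_wsum.
suff [-> ->] : wsum x (fun I : {set G} => 1 * #|I|%:R) = wsum x (@occupied R G) /\
    wsum x (fun I : {set G} => 1 * #|I|%:R * #|I|%:R) =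
    wsum x (fun I : {set G} => occupied R I * occupied R I) by [].
by split; apply: eq_bigr => I _; rewrite mul1r.
Qed.
End VarianceFraction.

(** * The bound and its equality case *)

Theorem corollary1p6 (R : realType) (G : sgraph) (hG : (0 < #|G|)%N)
    (l : R) (hl : 0 < l) :
  let chi := edge_chromatic_number G in
  let bound := l / (1 + chi.+1%:R * l) ^+ 2 in
  bound <= variance_fraction G l /\
  (variance_fraction G l = bound <->
     disjoint_union_of_copies G (complete chi.+1) /\ (chi = 0%N \/ odd chi)).
Proof.
move=> chi bound.
have [lb eq_lb] := wsum_variance hl (@card_closed_nbhd_le G).
have Z_gt0 := wsum1_gt0 G hl.
have n_gt0 : 0 < #|G|%:R :> R by rewrite ltr0n.
have D_gt0 : 0 < 1 + chi.+1%:R * l by rewrite ltr_wpDr ?mulr_ge0 ?ltW.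
move: lb eq_lb; rewrite -/chi /bound (variance_fraction_wsum _ hl).
set V := _ * _ - _; set Z := wsum l _ in Z_gt0 *; set n : R := #|G|%:R in n_gt0 *.
set d := 1 + _ => lb eq_lb.
have nZ_gt0 : 0 < n * Z ^+ 2 by rewrite mulr_gt0 ?exprn_gt0.
have -> : n^-1 * (V / Z ^+ 2) = V / (n * Z ^+ 2) by rewrite [(n * _)^-1]invfM mulrCA.
have d2_gt0 : 0 < d ^+ 2 by rewrite exprn_gt0.
split; first by rewrite ler_pdivlMr // mulrAC ler_pdivrMr // mulrA.
have nZ_neq0 := lt0r_neq0 nZ_gt0; have d2_neq0 := lt0r_neq0 d2_gt0.
(* Cross-multiplying turns equality of the fractions into the equality case of [wsum_variance]. *)
have eqE : V / (n * Z ^+ 2) = l / d ^+ 2 <-> V * d ^+ 2 = l * n * Z ^+ 2.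
  rewrite -[l * n * _]mulrA.
  split=> [/eqP|eqV]; first by rewrite (eqr_div _ _ nZ_neq0 d2_neq0) => /eqP.
  by apply/eqP; rewrite (eqr_div _ _ nZ_neq0 d2_neq0) eqV.
apply: (iff_trans eqE); apply: (iff_trans eq_lb).
split=> [/card_free_clique_blocks blocks | [/copies_clique_blocks blocks _]].
  split; first exact: clique_blocks_copies.
  by have /card_gt0P[v _] := hG; exact: (clique_blocks_odd v).
by move=> I; exact: clique_blocks_card_free.
Qed.
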